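(* Let $n \in \mathbb{N}$ be an even number larger than some absolute constant $n_0$. There are parameters $\tau = \Omega(n/\log^6 n)$, $\eta = O(n^6 \log^8 n)$, $b = \Omega(n/\log^8 n)$, and a matrix $M \in \mathbb{R}^{(n/2) \times n}$, with $\Theta := M^TM$, with the following properties: (1) The rows of $M$ are $O(\log^2 n)$-sparse. (2) For any $x \in \mathbb{R}^n$ with $\mathrm{dist}(x,\ker M) \leq \|x\|_2/(12\sqrt{n})$, and any $S \subseteq [n]$ with $|S| \leq \tau$, it holds that $\|x_{S^c}\|_2 \geq \|x\|_2/(2\sqrt{n})$. (3) For any $B \subseteq [n/2]$ with $|B| \leq b$, there is a set $C \subseteq [n]$ with $|C| \leq 2|B|$ such that for any $x \in \mathbb{R}^n$, either $\|x_{C^c}\|_2 \leq \eta \|M_{B^c}x\|_2$, or $\|x\|_0 \geq \tau$. (4) $\|\Theta\|_F \leq O(n\log n)$. (5) The smallest nonzero eigenvalue $\lambda$ of $\Theta$ satisfies $\lambda \geq \Omega(n^{-5/2})$.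
   Context: $\mathrm{dist}(x,V)=\inf_{v\in V}\|x-v\|_2$. For $S\subseteq[n]$, $x_{S^c}$ is the restriction of $x$ to coordinates outside $S$; $M_{B^c}$ is the submatrix of rows of $M$ not indexed by $B$; $\|x\|_0$ is the number of nonzero entries. A vector is $s$-sparse if it has at most $s$ nonzero entries. $O,\Omega$ hide absolute constants. *)

(* Defs.v *)
From HB Require Import structures.
From mathcomp Require Export all_boot all_order all_algebra.
From mathcomp Require Export all_classical all_reals all_analysis.

Set Implicit Arguments.
Unset Strict Implicit.
Unset Printing Implicit Defensive.

Import Order.TTheory GRing.Theory Num.Theory.
Local Open Scope classical_set_scope.
Local Open Scope ring_scope.

(* The norm that MathComp-Analysis puts on matrices is the max norm, hence the
   explicit Euclidean norm. *)
Definition l2norm (R : realType) (n : nat) (x : 'cV[R]_n) : R :=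
  Num.sqrt (\sum_(i < n) x i 0 ^+ 2).

Definition frobenius_norm (R : realType) (m n : nat) (A : 'M[R]_(m, n)) : R :=
  Num.sqrt (\sum_(i < m) \sum_(j < n) A i j ^+ 2).

Definition l2dist (R : realType) (n : nat) (x : 'cV[R]_n) (V : set 'cV[R]_n) : R :=
  inf [set l2norm (x - v) | v in V].

(* Kernel of x |-> M x on column vectors; MathComp's [kermx] is the left kernel. *)
Definition col_kernel (R : realType) (m n : nat) (M : 'M[R]_(m, n)) : set 'cV[R]_n :=
  [set v | M *m v = 0].

(* The rows indexed by S, in increasing order; on a column vector this is the
   restriction to the coordinates in S. *)
Definition rows_in (R : realType) (m n : nat) (S : {set 'I_m})
    (A : 'M[R]_(m, n)) : 'M[R]_(#|S|, n) :=
  rowsub (fun k : 'I_#|S| => enum_val k) A.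

(* Stated for matrices so that it applies to row and to column vectors. *)
Definition l0norm (R : realType) (m n : nat) (A : 'M[R]_(m, n)) : nat :=
  #|[pred ij : 'I_m * 'I_n | A ij.1 ij.2 != 0]|.

Definition sparse (R : realType) (m n : nat) (s : R) (A : 'M[R]_(m, n)) : Prop :=
  (l0norm A)%:R <= s.

Definition smallest_nonzero_eigenvalue (R : realType) (n : nat)
    (A : 'M[R]_n) (lambda : R) : Prop :=
  [/\ eigenvalue A lambda, lambda != 0 &
      forall mu : R, eigenvalue A mu -> mu != 0 -> lambda <= mu].

(* Main.v *)
Require Import Defs.
From mathcomp Require Import all_boot all_order all_fingroup all_algebra.
From mathcomp Require Import all_classical all_reals all_analysis.
From mathcomp Require Import zify ring lra complex.

Set Implicit Arguments.
Unset Strict Implicit.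
Unset Printing Implicit Defensive.

Import Order.TTheory GRing.Theory Num.Theory.

(** Every column of [M] has 40 entries [+1] or [-1], placed by a lossless
    expander: a set [S] of at most [c n] columns meets at least [35 #|S|] rows.
    Such an expander yields [||M x||_1 >= 30 ||x||_1] for sparse [x], which gives
    (2); for (3), a largest non-expanding set [C] relative to the deleted rows
    [B] is small, and off [C] the expansion survives the deletion of [B] and of
    all the rows that [C] meets.
    For (5), half of the columns form a square block [I + H], where [H] is
    antisymmetric: then [<y, (I + H) y> = ||y||^2], so that the nonzero
    eigenvalues of [M^T M] are at least [1].  Both [H] and the other columns come
    from permutations, and a union bound shows that most choices expand. *)

(** * Counting expanding permutations *)

(** Expansion controls [M] on sparse vectors only and says nothing about small singular values,
    which involve dense vectors. The antisymmetric part settles those for every choice of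
    permutations, so that randomness has to provide expansion alone. The price is that the
    permutations of the block must expand together with their inverses, and that they are fixed
    before the remaining columns are counted. Permutations, rather than arbitrary random maps, keep
    the rows sparse without a further probabilistic argument. A loss of 5 out of 40 slots gives the
    factor 2 * 35 - 40 = 30; deleting rows doubles the loss, and 2 * 30 - 40 = 20 is still positive.
    All thresholds come out linear in [n], so the logarithms of the statement are slack. *)

Lemma card_perm_insert (X : finType) (T U : {set X}) (j : X) : j \notin T ->
  (#|[set s : {perm X} | [forall x in j |: T, s x \in U]]| * (#|X| - #|T|) <=
   #|[set s : {perm X} | [forall x in T, s x \in U]]| * (#|U| - #|T|))%N.
Proof.
move=> jT.
set F' := [set s : {perm X} | [forall x in j |: T, s x \in U]].
set F := [set s : {perm X} | [forall x in T, s x \in U]].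
pose A := [set si : {perm X} * X | (si.1 \in F) && ((si.2 \notin T) && (si.1 si.2 \in U))].
pose h (si : {perm X} * X) : {perm X} * X := ((tperm j si.2 * si.1)%g, si.2).
have cA : #|A| = (#|F| * (#|U| - #|T|))%N.
  rewrite cardsE -sum1_card.
  rewrite -(pair_big_dep (fun s => s \in F) (fun s i => (i \notin T) && (s i \in U)) (fun
    _ _ => 1%N)) /=.
  rewrite -sum_nat_const; apply: eq_bigr => s; rewrite inE => /forall_inP sT.
  rewrite sum1_card -(card_preimset U (@perm_inj _ s)).
  rewrite -cardsDS; last by apply/fintype.subsetP => x xT; rewrite inE sT.
  by apply: eq_card => x; rewrite !inE.
rewrite -cA -[X in (_ * (X - _))%N]cardsT -cardsDS ?finset.subsetT// -cardsX.
rewrite -(card_in_imset (f := h)) ?subset_leq_card//.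
  apply/fintype.subsetP => _ /imsetP[[s i]] + ->.
  rewrite !inE /= andbT => /andP[/forall_inP sT iT]; rewrite iT /= permM tpermR.
  rewrite sT ?setU11 // andbT; apply/forall_inP => x xT;
    rewrite permM tpermD ?sT ?setU1r //.
    by apply: contraNneq jT => ->.
  by apply: contraNneq iT => ->.
move=> [s i] [s' i'] _ _ [/= e ei]; move: e; rewrite ei => /mulgI ->; by [].
Qed.

(** Drawing without replacement is no likelier to stay in [U] than drawing with replacement:
    inserting one more point by the switch of [j] and [i] costs a ratio [(u - n) / (q - n)], which
    is at most [u / q] because [u <= q]. *)
Lemma card_perm_sub (X : finType) (T U : {set X}) :
  (#|[set s : {perm X} | [forall x in T, s x \in U]]| * #|X| ^ #|T| <=
   #|U| ^ #|T| * (#|X|)`!)%N.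
Proof.
elim: {T}#|T| {-2}T (erefl #|T|) => [|n IHn] T cT.
  have -> : (#|X|)`! = #|perm_on [set: X]| by rewrite card_perm cardsT.
  rewrite cT !expn0 muln1 mul1n; apply: subset_leq_card.
  by apply/fintype.subsetP => s _; apply/fintype.subsetP => x _; rewrite inE.
have /card_gt0P[j jT] : (0 < #|T|)%N by rewrite cT.
have := @card_perm_insert X (T :\ j) U j;
  rewrite finset.setD1K // finset.setD11 => /(_ isT).
have cT' : #|T :\ j| = n by move: cT; rewrite (cardsD1 j) jT => -[].
have := IHn _ cT'; rewrite cT' cT.
have : (#|U| <= #|X|)%N by exact: max_card.
have : (n < #|X|)%N by rewrite -cT max_card.
set f' := #|[set s : {perm X} | [forall x in T, s x \in U]]|.
set f := #|[set s : {perm X} | [forall x in _, s x \in U]]|.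
move: f' f #|X| #|U| => f' f q u nq uq h1 h2; rewrite !expnS.
suff h3 : (f' * q <= f * u)%N.
  apply: (@leq_trans (f * u * q ^ n)); first by rewrite mulnA leq_mul2r h3 orbT.
  by rewrite -mulnA mulnCA -mulnA leq_mul2l h1 orbT.
rewrite -(leq_pmul2r (m := q - n)) ?subn_gt0 //.
have h4 : ((u - n) * q <= u * (q - n))%N by rewrite mulnBl mulnBr leq_sub2l// [(n *
  q)%N]mulnC leq_mul2r uq orbT.
have h5 := leq_mul (leqnn f) h4.
have h6 := leq_mul h2 (leqnn q).
lia.
Qed.

(** A substitute for Stirling's formula: the power is below a falling factorial of [x + u], which is
    the factorial of [u] times a binomial coefficient. *)
Lemma expn_le_fact_exp2 (x u : nat) : (x ^ u <= u`! * 2 ^ (x + u))%N.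
Proof.
have binle n m : ('C(n, m) <= 2 ^ n)%N.
  elim: n m => [|n IHn] [|m] //=; first by rewrite bin0 expn_gt0.
  by rewrite binS expnS mul2n -addnn leq_add.
have ffle : (x ^ u <= (x + u) ^_ u)%N.
  elim: u => [|u IHu]; first by rewrite ffactn0.
  by rewrite addnS ffactnS /= expnS leq_mul // leqW ?leq_addr.
by apply: (leq_trans ffle); rewrite -bin_ffact mulnC leq_mul2l binle orbT.
Qed.

Lemma bin_mul_fact_le (n k : nat) : ('C(n, k) * k`! <= n ^ k)%N.
Proof.
rewrite bin_ffact; elim: k => [|k IHk]; first by rewrite ffactn0.
by rewrite ffactnSr expnSr leq_mul ?leq_subr.
Qed.

Lemma card_le_cover (I T : finType) (A : {set T}) (P : pred I) (E : I -> {set T}) :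
  (forall x, x \in A -> exists2 i, P i & x \in E i) ->
  (#|A| <= \sum_(i | P i) #|E i|)%N.
Proof.
move=> AE; under eq_bigr do rewrite -sum1_card.
rewrite (exchange_big_dep xpredT) //= -sum1_card [leqLHS]big_mkcond.
apply: leq_sum => x _; case: ifP => // /AE[i Pi xi].
by rewrite (bigD1 i) ?Pi.
Qed.

Lemma subset_card_exact (T : finType) (A : {set T}) (u : nat) :
  (#|A| <= u)%N -> (u <= #|T|)%N -> exists2 U : {set T}, A \subset U & #|U| = u.
Proof.
move=> Au; elim: {u}(u - #|A|)%N {-2}u (erefl (u - #|A|)%N) Au => [|k IHk] u uk Au uT.
  by exists A => //; apply/eqP; rewrite eqn_leq Au -subn_eq0 uk.
case: u uk Au uT => // u uk Au uT.
have [|||U AU cU] := IHk u; try lia.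
have /card_gt0P[y] : (0 < #|~: U|)%N by rewrite cardsCs finset.setCK cU subn_gt0.
rewrite inE => yU; exists (y |: U); last by rewrite cardsU1 yU cU.
exact: fintype.subset_trans AU (finset.subsetUr _ _).
Qed.

(* The column [c] of the matrix has its entries in the rows [rho c k], one for each
   slot [k]; several slots of a column may share a row. *)
Definition slot_nbhd (C Y : finType) (D : nat) (rho : C -> 'I_D -> Y)
    (S : {set C}) : {set Y} :=
  [set y | [exists c in S, exists k, rho c k == y]].

Lemma slot_nbhdP (C Y : finType) (D : nat) (rho : C -> 'I_D -> Y)
    (S : {set C}) (y : Y) :
  reflect (exists c k, c \in S /\ rho c k = y) (y \in slot_nbhd rho S).
Proof.
rewrite inE; apply: (iffP exists_inP) => [[c cS /existsP[k /eqP e]]|[c [k [cS e]]]].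
  by exists c, k.
by exists c => //; apply/existsP; exists k; rewrite e.
Qed.

Lemma card_slot_nbhd_le (C Y : finType) (D : nat) (rho : C -> 'I_D -> Y)
    (S : {set C}) : (#|slot_nbhd rho S| <= D * #|S|)%N.
Proof.
have -> : slot_nbhd rho S = [set rho ck.1 ck.2 | ck in finset.setX S [set: 'I_D]].
  apply/setP => y; apply/slot_nbhdP/imsetP => [[c [k [cS <-]]]|[[c k]]].
    by exists (c, k) => //; rewrite !inE cS.
  by rewrite !inE andbT => cS ->; exists c, k.
by rewrite (leq_trans (leq_imset_card _ _)) // cardsX cardsT card_ord mulnC.
Qed.

(** A deficit above [2 * s] confines the neighbourhood outside [W] to a set [U] of
    [u = D * #|T| - 2 * s] rows, so all [D] permutations map [T] into the at most [2 * D * s] points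
    above [W :|: U]. Choosing [U] costs only [#|X| ^ u] against the gain [#|X| ^ (D * #|T|)]; the
    surplus [#|X| ^ (2 * s)] later pays for the choice of [s] columns. *)
Lemma card_nonexpanding_perms (X Y : finType) (psi : X -> Y) (D s : nat)
    (T : {set X}) (W : {set Y}) :
  (#|Y| <= #|X|)%N -> (forall y, #|[set x | psi x == y]| <= 2)%N ->
  (D * #|T| <= #|Y|)%N -> (#|W| + D * #|T| <= D * s)%N ->
  (#|[set P : {ffun 'I_D -> {perm X}} |
       #|slot_nbhd (fun x k => psi (P k x)) T :\: W| + 2 * s < D * #|T| ]|
     * #|X| ^ (2 * s) <= 2 ^ (3 * D * s) * (2 * D * s) ^ (2 * s) * (#|X|)`! ^ D)%N.
Proof.
move=> YX psi2 TY WT.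
set A := [set P | _].
(* In the application [T] is only a part of a set of [s] columns, so it may be too small for a
   deficit of [2 * s]. *)
have [Ts|sT] := leqP (D * #|T|) (2 * s).
  rewrite (_ : A = finset.set0) ?cards0 //; apply/setP => P; rewrite !inE.
  by apply/negbTE; rewrite -leqNgt (leq_trans Ts) // leq_addl.
pose u := (D * #|T| - 2 * s)%N.
pose F (U : {set Y}) := [set r : {perm X} | [forall x in T, psi (r x) \in W :|: U]].
pose E U := [set P : {ffun 'I_D -> {perm X}} | P \in ffun_on (mem (F U))].
have cA : (#|A| <= \sum_(U : {set Y} | #|U| == u) #|E U|)%N.
  apply: card_le_cover => P; rewrite inE => PA.
  have [||U NU cU] := @subset_card_exact _ (slot_nbhd (fun x k => psi (P k x)) T :\: W) u.
  - by rewrite /u leq_subRL ?(ltnW sT) // addnC; exact: ltnW PA.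
  - exact: leq_trans (leq_subr _ _) TY.
  exists U; first by rewrite cU.
  rewrite inE; apply/ffun_onP => k; rewrite inE; apply/forall_inP => x xT.
  rewrite inE; case: (boolP (psi (P k x) \in W)) => //= nW.
  apply: (fintype.subsetP NU); rewrite inE nW; apply/slot_nbhdP.
  by exists x, k.
have cF (U : {set Y}) : #|U| == u -> (#|F U| * #|X| ^ #|T| <= (2 * D * s) ^ #|T| *
  (#|X|)`!)%N.
  move=> /eqP cU.
  have -> : F U = [set r : {perm X} | [forall x in T, r x \in psi @^-1: (W :|: U)]].
    by apply/setP => r; rewrite !inE; apply: eq_forallb => x; rewrite !inE.
  apply: (leq_trans (card_perm_sub _ _)); rewrite leq_mul2r; apply/orP; right.
  have t0 : (0 < #|T|)%N by rewrite lt0n; apply: contraTneq sT => ->; rewrite muln0.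
  rewrite leq_exp2r //.
  apply: (@leq_trans (2 * #|W :|: U|)); last first.
    rewrite -mulnA leq_mul2l /=; apply: leq_trans WT.
    by rewrite (leq_trans (leq_card_setU _ _)) // leq_add2l cU leq_subr.
  apply: (@leq_trans (\sum_(y in W :|: U) #|[set x | psi x == y]|)).
    by apply: card_le_cover => x; rewrite inE => xZ; exists (psi x); rewrite // inE.
  by rewrite mulnC -sum_nat_const; apply: leq_sum.
have cAq : (#|A| * #|X| ^ (D * #|T|) <=
    'C(#|Y|, u) * ((2 * D * s) ^ (D * #|T|) * (#|X|)`! ^ D))%N.
  apply: (leq_trans (leq_mul cA (leqnn _))).
  have -> : 'C(#|Y|, u) = (\sum_(U : {set Y} | #|U| == u) 1)%N.
    by rewrite -card_draws -sum1_card; apply: eq_bigl => U; rewrite inE.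
  rewrite !big_distrl /=.
  apply: leq_sum => U cU; rewrite mul1n cardsE card_ffun_on card_ord.
  rewrite ![(D * #|T|)%N]mulnC !expnM -!expnMn.
  have D0 : (0 < D)%N by rewrite lt0n; apply: contraTneq sT => ->; rewrite mul0n.
  by rewrite leq_exp2r //; exact: cF.
have DTu : (D * #|T| = u + 2 * s)%N by rewrite /u; lia.
have uDs : (u <= D * s)%N by apply: leq_trans (leq_subr _ _) _; apply: leq_trans WT;
  exact: leq_addl.
have X0 : (0 < #|X| ^ u)%N.
  rewrite expn_gt0 orbC; case: (posnP u) => //= u0; apply: leq_trans YX;
    apply: leq_trans TY.
  by apply: leq_trans sT; rewrite ltnS.
rewrite -(leq_pmul2l (fact_gt0 u)) -(leq_pmul2l X0).
apply: (@leq_trans (u`! * (#|A| * #|X| ^ (D * #|T|)))).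
  by rewrite DTu expnD; apply/eq_leq; ring.
apply: (leq_trans (leq_mul (leqnn _) cAq)).
have hC : ('C(#|Y|, u) * u`! <= #|X| ^ u)%N.
  apply: (leq_trans (bin_mul_fact_le _ _)).
  by case: (u) => // v; rewrite leq_exp2r.
have hx : ((2 * D * s) ^ u <= u`! * 2 ^ (3 * D * s))%N.
  apply: (leq_trans (expn_le_fact_exp2 _ _)); rewrite leq_mul2l leq_exp2l //.
  by apply/orP; right; lia.
rewrite DTu expnD.
have := leq_mul (leq_mul hC hx) (leqnn ((2 * D * s) ^ (2 * s) * (#|X|)`! ^ D)).
by rewrite !mulnA; congr (_ <= _)%N; ring.
Qed.

Lemma geometric_union_bound (B : nat -> nat) (Q tau : nat) :
  (forall s, 0 < s <= tau -> B s * 8 ^ s <= Q)%N ->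
  (7 * \sum_(1 <= s < tau.+1) B s <= Q)%N.
Proof.
(* The exact partial sum of the geometric series, [1 - 8 ^ -tau], is what passes through the
   induction. *)
move=> hB; suff : (7 * (8 ^ tau * \sum_(1 <= s < tau.+1) B s) + Q <= 8 ^ tau * Q)%N.
  move=> h; have h8 : (0 < 8 ^ tau)%N by rewrite expn_gt0.
  by rewrite -(leq_pmul2l h8) mulnCA (leq_trans (leq_addr Q _)).
elim: tau hB => [|t IHt] hB; first by rewrite big_geq // !muln0 expn0 mul1n.
rewrite big_nat_recr //= mulnDr expnS.
have hS := hB t.+1 (leqnn _).
have {}IHt := IHt (fun s hs => hB s (introT andP (conj (proj1 (andP hs)) (leqW (proj2
  (andP hs)))))).
have h1 := leq_mul (leqnn 8) IHt; have h2 := leq_mul (leqnn 7) hS.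
rewrite expnS in h2.
have := leq_add h1 h2; set x := (8 ^ t)%N; set y := (\sum_(1 <= s < t.+1) B s)%N.
rewrite -/x in h2; nia.
Qed.

(** [W S] stands for the rows already taken by the columns of [S] outside the random part: it may
    vary with [S], but not with [P]. *)
Lemma few_nonexpanding_perms (V X Y : finType) (psi : X -> Y) (D tau : nat)
    (T : {set V} -> {set X}) (W : {set V} -> {set Y}) :
  (0 < D)%N -> (#|Y| <= #|X|)%N -> (#|V| <= 2 * #|X|)%N ->
  (forall y, #|[set x | psi x == y]| <= 2)%N ->
  (forall S, #|W S| + D * #|T S| <= D * #|S|)%N ->
  (256 * 8 ^ D * D ^ 2 * tau <= #|Y|)%N ->
  (7 * #|[set P : {ffun 'I_D -> {perm X}} | [exists S : {set V}, (#|S| <= tau) &&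
       (#|slot_nbhd (fun x k => psi (P k x)) (T S) :\: W S| + 2 * #|S| < D * #|T S|)]]|
     <= (#|X|)`! ^ D)%N.
Proof.
move=> D0 YX VX psi2 WT Ktau.
pose bad S := [set P : {ffun 'I_D -> {perm X}} |
  #|slot_nbhd (fun x k => psi (P k x)) (T S) :\: W S| + 2 * #|S| < D * #|T S| ].
set Q := (_ ^ D)%N.
have badS s : (0 < s <= tau)%N -> ((\sum_(S : {set V} | #|S| == s) #|bad S|) * 8 ^ s <=
  Q)%N.
  move=> /andP[s0 st].
  have Ks : (256 * 8 ^ D * D ^ 2 * s <= #|X|)%N.
    by apply: leq_trans YX; apply: leq_trans Ktau; rewrite leq_mul2l st orbT.
  have X0 : (0 < #|X|)%N by apply: leq_trans Ks; rewrite !muln_gt0 !expn_gt0 D0 s0.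
  have badq (S : {set V}) : #|S| == s ->
      (#|bad S| * #|X| ^ (2 * s) <= 2 ^ (3 * D * s) * (2 * D * s) ^ (2 * s) * Q)%N.
    move=> /eqP cS; rewrite /bad cS; apply: card_nonexpanding_perms => //;
      last by rewrite -cS.
    apply: (@leq_trans (D * s)); first by rewrite -cS;
      exact: leq_trans (leq_addl _ _) (WT S).
    apply: leq_trans Ktau; apply: (leq_mul _ st); rewrite -[leqLHS]mul1n.
    by apply: leq_mul; rewrite ?muln_gt0 ?expn_gt0 // expnS expn1 leq_pmulr.
  have sumq : ((\sum_(S : {set V} | #|S| == s) #|bad S|) * #|X| ^ (2 * s) <=
      'C(#|V|, s) * (2 ^ (3 * D * s) * (2 * D * s) ^ (2 * s) * Q))%N.
    have -> : 'C(#|V|, s) = (\sum_(S : {set V} | #|S| == s) 1)%N.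
      by rewrite -card_draws -sum1_card; apply: eq_bigl => S; rewrite inE.
    by rewrite !big_distrl /=; apply: leq_sum => S cS; rewrite mul1n badq.
  move: sumq; set b := (\sum_(S | _) _)%N; set q := #|X| => sumq.
  have hC : ('C(#|V|, s) * s`! <= (2 * q) ^ s)%N.
    by apply: (leq_trans (bin_mul_fact_le _ _)); rewrite leq_exp2r.
  have hs : (s ^ s <= s`! * 4 ^ s)%N.
    by apply: leq_trans (expn_le_fact_exp2 s s) _; rewrite addnn -mul2n expnM.
  have q0 : (0 < q ^ s)%N by rewrite expn_gt0 X0.
  rewrite -(leq_pmul2l (fact_gt0 s)) -(leq_pmul2l q0) -(leq_pmul2l q0).
  apply: (@leq_trans (s`! * (b * q ^ (2 * s)) * 8 ^ s)).
    by rewrite mul2n -addnn expnD; apply/eq_leq; ring.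
  apply: (@leq_trans ((2 * q) ^ s * (s`! * 4 ^ s) * ((8 ^ D) ^ s * (4 * D ^ 2 * s) ^ s *
    8 ^ s) * Q)).
    have := leq_mul (leq_mul hC hs) (leqnn ((8 ^ D) ^ s * (4 * D ^ 2 * s) ^ s * 8 ^ s * Q)).
    have := leq_mul (leq_mul (leqnn s`!) sumq) (leqnn (8 ^ s)).
    have e1 : ((2 * D * s) ^ (2 * s) = (4 * D ^ 2 * s) ^ s * s ^ s)%N.
      by rewrite expnM -expnMn; congr (_ ^ _)%N; ring.
    have e2 : (2 ^ (3 * D * s) = (8 ^ D) ^ s)%N by rewrite -mulnA expnM expnM.
    rewrite e1 e2 => h1 h2; apply: (leq_trans h1).
    by apply: (leq_trans _ (leq_trans h2 _)); apply/eq_leq; ring.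
  (* The factor [8 ^ D] comes from [2 ^ (3 * D * s)], and 256 is the product of 2 from [VX], 4 from
     [hs], 4 from [(2 * D * s) ^ (2 * s)] and 8 for the geometric series. One [s ^ s] is absorbed by
     the factorial in the binomial coefficient, the other is the [s] in this base. *)
  have K's : ((256 * 8 ^ D * D ^ 2 * s) ^ s <= q ^ s)%N by rewrite leq_exp2r.
  have := leq_mul (leq_mul (leqnn (q ^ s * s`!)) K's) (leqnn Q).
  move=> h; apply: (leq_trans _ (leq_trans h _)); apply/eq_leq; last by ring.
  by rewrite (_ : 256 = 2 * 4 * 4 * 8)%N // !expnMn; ring.
apply: leq_trans (geometric_union_bound badS); rewrite leq_mul2l /=.
apply: (@leq_trans (\sum_(S : {set V} | 0 < #|S| <= tau) #|bad S|)).
  apply: card_le_cover => P; rewrite inE => /existsP[S /andP[St SP]].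
  exists S; last by rewrite inE.
  rewrite St andbT lt0n; apply: contraTneq SP => S0.
  rewrite -leqNgt (leq_trans _ (leq0n _)) //.
  by apply: (leq_trans (leq_addl #|W S| _)); rewrite (leq_trans (WT S)) // S0 muln0.
rewrite (partition_big (fun S : {set V} => inord #|S| : 'I_tau.+1) (fun s => 0 < s)%N) /=;
  last first.
  by move=> S /andP[S0 St]; rewrite inordK.
rewrite big_add1 /= [leqRHS]big_mkord [leqLHS]big_mkcond big_ord_recl /= add0n.
apply: leq_sum => i _; rewrite [leqRHS]big_mkcond [leqLHS]big_mkcond.
apply: leq_sum => S _; case: ifP => // /andP[/andP[_ St]] /eqP/(congr1 val).
by rewrite /= inordK // => ->; rewrite eqxx.
Qed.

(** * The slots of the matrix *)

Lemma card_sum_set (A B : finType) (S : {set A + B}) :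
  #|S| = (#|[set x | inl x \in S]| + #|[set y | inr y \in S]|)%N.
Proof.
rewrite -sum1_card (big_sumType) /= -!sum1_card.
by congr (_ + _)%N; apply: eq_bigl => x; rewrite inE.
Qed.

Lemma card_bool_prod_set (A : finType) (S : {set bool * A}) :
  #|S| = (#|[set x | (true, x) \in S]| + #|[set x | (false, x) \in S]|)%N.
Proof.
rewrite -sum1_card (eq_bigl (fun u : bool * A => xpredT u.1 && ((u.1, u.2) \in S)));
  last by case.
rewrite -(pair_big_dep xpredT (fun b x => (b, x) \in S) (fun _ _ => 1%N)) /= big_bool
  -!sum1_card.
by congr (_ + _)%N; apply: eq_bigl => x; rewrite inE.
Qed.

Lemma card_perm_type (X : finType) : #|{perm X}| = (#|X|)`!.
Proof.
rewrite -[in RHS]cardsT -card_perm; apply: eq_card => s; rewrite !inE.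
by apply/esym/fintype.subsetP => x _; rewrite inE.
Qed.

Lemma exists_two_to_one (Y : finType) (a : nat) : (0 < #|Y|)%N -> (a <= 2 * #|Y|)%N ->
  exists psi : 'I_a -> Y, forall y, (#|[set x | psi x == y]| <= 2)%N.
Proof.
move=> Y0 aY; have [y0 _] := card_gt0P Y0.
exists (fun x => nth y0 (enum Y) (x %% #|Y|)) => y; set F := [set x | _].
rewrite -[leqRHS]card_ord -(card_in_imset (f := fun x : 'I_a => inord (x %/ #|Y|) :
  'I_2)) ?max_card //.
have div2 (x : 'I_a) : (x %/ #|Y| < 2)%N by rewrite ltn_divLR // (leq_trans (ltn_ord x)).
move=> x x'; rewrite !inE => /eqP <- /eqP/esym/eqP.
rewrite nth_uniq -?cardE ?ltn_pmod ?enum_uniq // => /eqP e /(congr1 val).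
by rewrite /= !inordK // => e'; apply: val_inj; rewrite /= (divn_eq x #|Y|) e e' -divn_eq.
Qed.

(** Each direction fails for at most one seventh of the tuples, because entrywise inversion is a
    bijection on tuples; hence some tuple is good in both. *)
Lemma exists_two_sided_expander (p d tau : nat) : (0 < d)%N ->
  (256 * 8 ^ d * d ^ 2 * tau <= p)%N ->
  exists pi : 'I_d -> {perm 'I_p}, forall T : {set 'I_p}, (#|T| <= tau)%N ->
    (d * #|T| <= #|slot_nbhd (fun i k => pi k i) T| + 2 * #|T|)%N /\
    (d * #|T| <= #|slot_nbhd (fun i k => (pi k)^-1%g i) T| + 2 * #|T|)%N.
Proof.
move=> d0 Ktau.
set bad := [set P : {ffun 'I_d -> {perm 'I_p}} | [exists T : {set 'I_p}, (#|T| <= tau) &&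
  (#|slot_nbhd (fun x k => P k x) T :\: finset.set0| + 2 * #|T| < d * #|T|)]].
have cbad : (7 * #|bad| <= p`! ^ d)%N.
  have := @few_nonexpanding_perms 'I_p 'I_p 'I_p id d tau id (fun _ => finset.set0) d0.
  rewrite card_ord; apply=> //; first by rewrite leq_pmull.
    by move=> y; rewrite (_ : [set x | _] = [set y]) ?cards1 //; apply/setP => x;
      rewrite !inE.
  by move=> S; rewrite cards0.
pose inv (P : {ffun 'I_d -> {perm 'I_p}}) := [ffun k => (P k)^-1%g].
have inv_inj : injective inv.
  by move=> P P' /ffunP e; apply/ffunP => k; have := e k; rewrite !ffunE => /invg_inj.
have : (#|bad :|: inv @^-1: bad| < #|{ffun 'I_d -> {perm 'I_p}}|)%N.
  apply: (leq_ltn_trans (leq_card_setU _ _));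
    rewrite card_preimset // card_ffun card_perm_type !card_ord.
  have : (0 < p`! ^ d)%N by rewrite expn_gt0 fact_gt0.
  by move: cbad; lia.
rewrite -cardsT -subn_gt0 -cardsDS ?finset.subsetT // => /card_gt0P[P].
rewrite !inE andbT negb_or !negb_exists => /andP[/forallP P1 /forallP P2].
exists P => T cT; move: (P1 T) (P2 T); rewrite cT /= -!leqNgt !finset.setD0; split => //.
rewrite (_ : slot_nbhd _ T = slot_nbhd (fun x k => inv P k x) T) //.
by apply/setP => y; rewrite !inE; apply: eq_existsb => x; congr andb;
  apply: eq_existsb => k; rewrite ffunE.
Qed.

(** The column [inl (b, i)] carries the identity in slot [0]; its other slots go
    to the rows of the opposite sign [~~ b] through [pi k] or its inverse, with
    opposite values, so that the square block is the identity plus an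
    antisymmetric matrix. *)
Definition block_slot (p a d : nat) (pi : 'I_d -> {perm 'I_p})
    (psi : 'I_a -> bool * 'I_p) (P : 'I_d.+1 -> {perm 'I_a})
    (c : bool * 'I_p + 'I_a) (k : 'I_d.+1) : bool * 'I_p :=
  match c with
  | inl bi => if unlift ord0 k is Some k' then
                (~~ bi.1, if bi.1 then (pi k')^-1%g bi.2 else pi k' bi.2)
              else bi
  | inr x => psi (P k x)
  end.

Definition block_sign (p a d : nat) (c : bool * 'I_p + 'I_a) (k : 'I_d.+1) : bool :=
  if c is inl (true, _) then k != ord0 else false.

Lemma exists_expanding_blocks (p a d tau : nat) : (0 < p)%N -> (0 < d)%N ->
  (2 * p <= a)%N -> (a <= 4 * p)%N -> (256 * 8 ^ d.+1 * d.+1 ^ 2 * tau <= p)%N ->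
  exists pi psi (P : 'I_d.+1 -> {perm 'I_a}),
    (forall y : bool * 'I_p, #|[set x | psi x == y]| <= 2)%N /\
    (forall S : {set bool * 'I_p + 'I_a}, (#|S| <= tau)%N ->
       (d.+1 * #|S| <= #|slot_nbhd (block_slot pi psi P) S| + 5 * #|S|)%N).
Proof.
move=> p0 d0 pa ap Ktau.
have cY : #|{: bool * 'I_p}| = (2 * p)%N by rewrite card_prod card_bool card_ord.
have [|pi piE] := @exists_two_sided_expander p d tau d0.
  apply: leq_trans Ktau; rewrite leq_mul2r; apply/orP; right.
  by apply: leq_mul; [rewrite leq_mul2l leq_exp2l ?leqnSn ?orbT | rewrite leq_exp2r
    ?leqnSn].
have [||psi psi2] := @exists_two_to_one (bool * 'I_p)%type a.
- by rewrite cY muln_gt0.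
- by rewrite cY mulnA.
pose SK (S : {set bool * 'I_p + 'I_a}) := [set bi | inl bi \in S].
pose SA (S : {set bool * 'I_p + 'I_a}) := [set x | inr x \in S].
pose kap (bi : bool * 'I_p) (k : 'I_d.+1) :=
  if unlift ord0 k is Some k' then
    (~~ bi.1, if bi.1 then (pi k')^-1%g bi.2 else pi k' bi.2) else bi.
(* With [pi] fixed, the block columns of [S] meet a definite set of rows; only the rows that the
   other columns add to it are random. *)
have := @few_nonexpanding_perms (bool * 'I_p + 'I_a)%type 'I_a (bool * 'I_p)%type psi
  d.+1 tau
  SA (fun S => slot_nbhd kap (SK S)) isT.
have V2 : (2 * p + a <= 2 * a)%N by rewrite [leqRHS]mul2n -addnn leq_add2r.
have WT (S : {set bool * 'I_p + 'I_a}) : (#|slot_nbhd kap (SK S)| + d.+1 * #|SA S| <=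
  d.+1 * #|S|)%N.
  by rewrite (card_sum_set S) mulnDr leq_add2r card_slot_nbhd_le.
have Y2 : (256 * 8 ^ d.+1 * d.+1 ^ 2 * tau <= 2 * p)%N by rewrite (leq_trans Ktau) //
  leq_pmull.
rewrite cY card_sum cY card_ord => /(_ pa V2 psi2 WT Y2).
set bad := [set P | _] => cbad.
have : (#|bad| < #|{ffun 'I_d.+1 -> {perm 'I_a}}|)%N.
  rewrite card_ffun card_perm_type !card_ord.
  have : (0 < a`! ^ d.+1)%N by rewrite expn_gt0 fact_gt0.
  by move: cbad; lia.
rewrite -cardsT -subn_gt0 -cardsDS ?finset.subsetT // => /card_gt0P[P].
rewrite !inE andbT negb_exists => /forallP PE.
exists pi, psi, P; split=> // S cS; have := PE S; rewrite cS /= -leqNgt.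
set N := slot_nbhd _ (SA S); set W := slot_nbhd _ (SK S) => hN.
have -> : slot_nbhd (block_slot pi psi P) S = W :|: N.
  apply/setP => y; rewrite finset.in_setU; apply/slot_nbhdP/orP.
    move=> [[bi|x] [k [cS' e]]]; [left|right]; apply/slot_nbhdP.
      by exists bi, k; rewrite inE.
    by exists x, k; rewrite inE.
  case=> /slot_nbhdP[c [k [+ e]]]; rewrite inE => cS'.
    by exists (inl c), k.
  by exists (inr c), k.
have cWN : #|W :|: N| = (#|W| + #|N :\: W|)%N.
  rewrite -cardsUI (_ : W :&: (N :\: W) = finset.set0) ?cards0 ?addn0; last first.
    by apply/setP => y; rewrite finset.in_setI finset.in_setD finset.in_set0;
      case: (y \in W).
  by apply: eq_card => y; rewrite !finset.in_setU finset.in_setD; case: (y \in W).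
have SKb b : (#|[set i | (b, i) \in SK S]| <= tau)%N.
  apply: leq_trans cS; rewrite (card_sum_set S) (leq_trans _ (leq_addr _ _)) //.
  by rewrite -/(SK S) (card_bool_prod_set (SK S)); case: b; rewrite ?leq_addl ?leq_addr.
(* The [true] columns reach [false] rows and conversely, so the two one-sided expansions add up
   without overlap. Slot [0] is not counted. *)
have cW : (d * #|SK S| <= #|W| + 2 * #|SK S|)%N.
  have [_ h1] := piE _ (SKb true); have [h2 _] := piE _ (SKb false).
  rewrite (card_bool_prod_set (SK S)) (card_bool_prod_set W).
  have l1 : (#|slot_nbhd (fun i k => (pi k)^-1%g i) [set i | (true, i) \in SK S]| <=
             #|[set i | (false, i) \in W]|)%N.
    apply/subset_leq_card/fintype.subsetP => y /slot_nbhdP[i [k [iS <-]]];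
      rewrite finset.in_set; rewrite finset.in_set in iS.
    by apply/slot_nbhdP; exists (true, i), (lift ord0 k); rewrite /kap liftK.
  have l2 : (#|slot_nbhd (fun i k => pi k i) [set i | (false, i) \in SK S]| <=
             #|[set i | (true, i) \in W]|)%N.
    apply/subset_leq_card/fintype.subsetP => y /slot_nbhdP[i [k [iS <-]]];
      rewrite finset.in_set; rewrite finset.in_set in iS.
    by apply/slot_nbhdP; exists (false, i), (lift ord0 k); rewrite /kap liftK.
  rewrite !mulnDr [in leqRHS](addnC #|[set x | (true, x) \in W]|) addnACA; apply: leq_add.
    by apply: leq_trans h1 _; rewrite leq_add2r.
  by apply: leq_trans h2 _; rewrite leq_add2r.
(* The total loss 5 is 2 from the random columns, 2 from the block and 1 from its uncounted identity
   slot. *)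
move: hN cW; rewrite cWN (card_sum_set S) -/(SK S) -/(SA S).
by move: #|_| #|_| #|_| #|_|; nia.
Qed.

(** * Expansion and the l1 norm *)

Local Open Scope ring_scope.

(* Removing the least nonzero value [m] of [a] from [a], and from [g] on the
   neighbourhood of the support of [a], preserves the hypotheses. *)
Lemma layer_cake_expansion (R : realDomainType) (C Y : finType) (D E : nat)
    (rho : C -> 'I_D -> Y) (Z : {set Y}) (a : C -> R) (g : Y -> R) :
  (forall c, 0 <= a c) -> (forall y, 0 <= g y) ->
  (forall c k, rho c k \notin Z -> a c <= g (rho c k)) ->
  (forall S : {set C}, (forall c, c \in S -> a c != 0) ->
     (E * #|S| <= #|slot_nbhd rho S :\: Z|)%N) ->
  E%:R * (\sum_c a c) <= \sum_(y | y \notin Z) g y.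
Proof.
have [n] := ubnP #|[set c | a c != 0]|; elim: n => // n IHn in a g *.
set T := [set c | _] => cT a0 g0 ag exp.
have aT c : c \notin T -> a c = 0 by rewrite inE negbK => /eqP.
have [T0|[c1 c1T]] := set_0Vmem T.
  rewrite big1 ?mulr0 ?sumr_ge0 // => c _; apply: aT; by rewrite T0 finset.in_set0.
have [c0 c0T' c0min] := arg_minP a c1T; have c0T : c0 \in T by [].
set m := a c0 in c0min.
set N := slot_nbhd rho T :\: Z.
pose a' c := a c - m * (c \in T)%:R; pose g' y := g y - m * (y \in N)%:R.
have m0 : 0 <= m by exact: a0.
have NP y : y \in N -> exists c k, [/\ c \in T, rho c k = y & y \notin Z].
  by rewrite /N finset.in_setD => /andP[yZ /slot_nbhdP[c [k [cT' e]]]]; exists c, k.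
have IH : E%:R * (\sum_c a' c) <= \sum_(y | y \notin Z) g' y.
  have a'0 c : a c = 0 -> a' c = 0.
    by move=> e; rewrite /a' !inE e eqxx mulr0 subr0.
  apply: IHn.
  - apply: (leq_trans _ (cT : (#|T| <= n)%N)); apply: proper_card; apply/fintype.properP;
    split.
      by apply/fintype.subsetP => c; rewrite !inE; apply: contra_neq; exact: a'0.
    by exists c0; rewrite // inE negbK /a' c0T mulr1 subrr.
  - move=> c; rewrite /a'; case: (boolP (c \in T)) => cT'; last by rewrite mulr0 subr0.
    by rewrite mulr1 subr_ge0 c0min.
  - move=> y; rewrite /g'; case: (boolP (y \in N)) => [yN|]; last by rewrite mulr0 subr0.
    have [c [k [cT' e yZ]]] := NP _ yN; rewrite mulr1 subr_ge0 -e.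
    by rewrite (le_trans (c0min _ cT')) // ag // e.
  - move=> c k yZ; case: (boolP (c \in T)) => cT'.
      have -> : a' c = a c - m by rewrite /a' cT' mulr1.
      have -> : g' (rho c k) = g (rho c k) - m; last by rewrite lerD2r ag.
      rewrite /g' /N finset.in_setD yZ /=;
        suff -> : rho c k \in slot_nbhd rho T by rewrite mulr1.
      by apply/slot_nbhdP; exists c, k.
    rewrite a'0 ?aT // /g'; case: (boolP (_ \in N)) => [yN|]; last by rewrite mulr0 subr0.
    have [c' [k' [cT'' e _]]] := NP _ yN; rewrite mulr1 subr_ge0 -e.
    by rewrite (le_trans (c0min _ cT'')) // ag // e.
  - by move=> S hS; apply: exp => c /hS; apply: contra_neq; exact: a'0.
have -> : \sum_c a c = \sum_c a' c + m * #|T|%:R.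
  rewrite -sum1_card natr_sum mulr_sumr [X in _ + X]big_mkcond -big_split /=.
  by apply: eq_bigr => c _; rewrite /a'; case: (c \in T);
    rewrite ?mulr1 ?mulr0 ?subr0 ?addr0 ?subrK.
have -> : \sum_(y | y \notin Z) g y = \sum_(y | y \notin Z) g' y + m * #|N|%:R.
  rewrite -sum1_card natr_sum mulr_sumr [X in _ + X](big_mkcond (fun y => y \in N)).
  rewrite [X in _ + X](bigID (fun y => y \in Z)) /= [X in _ + (X + _)]big1 ?add0r;
    last first.
    by move=> y yZ; rewrite /N finset.in_setD yZ.
  rewrite -big_split /=; apply: eq_bigr => y _.
  by rewrite /g'; case: (y \in N); rewrite ?mulr1 ?mulr0 ?subr0 ?addr0 ?subrK.
rewrite mulrDr lerD // mulrCA ler_wpM2l // -natrM ler_nat.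
by apply: exp => c; rewrite inE.
Qed.

(** Let [L y] be the l1 mass that enters row [y]. If [x c] enters there, the other terms can cancel
    at most [L y - |x c|] of it, so the absolute row value plus [L y] is at least [2 * |x c|]. The
    layer-cake bound applies to this sum, and the total of [L] is at most [D] times the l1 norm. *)
Lemma slot_l1_lower_bound (R : realDomainType) (C Y : finType) (D E : nat)
    (rho : C -> 'I_D -> Y) (Z : {set Y}) (s : C -> 'I_D -> R) (x : C -> R) :
  (forall c k, `|s c k| = 1) ->
  (forall S : {set C}, (forall c, c \in S -> x c != 0) ->
     (E * #|S| <= #|slot_nbhd rho S :\: Z|)%N) ->
  (2 * E%:R - D%:R) * (\sum_c `|x c|) <=
    \sum_(y | y \notin Z)
      `|\sum_(ck : C * 'I_D | rho ck.1 ck.2 == y) s ck.1 ck.2 * x ck.1|.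
Proof.
move=> s1 exp.
pose row y := \sum_(ck : C * 'I_D | rho ck.1 ck.2 == y) s ck.1 ck.2 * x ck.1.
pose L y := \sum_(ck : C * 'I_D | rho ck.1 ck.2 == y) `|x ck.1|.
have L0 y : 0 <= L y by exact: sumr_ge0.
have : E%:R * (\sum_c 2 * `|x c|) <= \sum_(y | y \notin Z) (`|row y| + L y).
  apply: (layer_cake_expansion (rho := rho)).
  - by move=> c; rewrite mulr_ge0.
  - by move=> y; rewrite addr_ge0.
  - move=> c k _; rewrite /row /L (bigD1 (c, k)) //= [X in _ + X](bigD1 (c, k)) //=.
    set r := \sum_(_ | _) _; set l := \sum_(_ | _) _.
    have : `|r| <= l.
      by apply: le_trans (ler_norm_sum _ _ _) _; apply: ler_sum => i _;
        rewrite normrM s1 mul1r.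
    have := ler_normB (s c k * x c + r) r; rewrite addrK normrM s1 mul1r.
    lra.
  - move=> S hS; apply: exp => c /hS; apply: contra_neq => ->; by rewrite normr0 mulr0.
rewrite -mulr_sumr big_split /=.
have : \sum_(y | y \notin Z) L y <= D%:R * \sum_c `|x c|.
  apply: (@le_trans _ _ (\sum_y L y)).
    by rewrite [leRHS](bigID (fun y => y \notin Z)) /= lerDl sumr_ge0.
  have <- : \sum_(ck : C * 'I_D) `|x ck.1| = D%:R * \sum_c `|x c|.
    rewrite -(pair_bigA _ (fun c (_ : 'I_D) => `|x c|)) /= mulr_sumr.
    by apply: eq_bigr => c _; rewrite sumr_const card_ord mulr_natl.
  by rewrite (partition_big (fun ck : C * 'I_D => rho ck.1 ck.2) xpredT).
rewrite /row; lra.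
Qed.

(** The threshold 10 is twice the loss of the expander, and the gap of 5 per column of [G] must be
    made up by rows in [B]. A set [S] violating the conclusion could be joined to [G], against
    maximality; the union has to stay within the range [tau]. *)
Lemma exists_absorbing_set (C Y : finType) (D tau : nat) (rho : C -> 'I_D -> Y)
    (B : {set Y}) :
  (forall S : {set C}, #|S| <= tau -> D * #|S| <= #|slot_nbhd rho S| + 5 * #|S|)%N ->
  exists G : {set C}, (5 * #|G| <= #|B|)%N /\
    forall S : {set C}, (#|S| + #|G| <= tau)%N -> [disjoint S & G] ->
      (D * #|S| <= #|slot_nbhd rho S :\: (B :|: slot_nbhd rho G)| + 10 * #|S|)%N.
Proof.
move=> expD.
pose P (G : {set C}) :=
  (#|G| <= tau)%N && (#|slot_nbhd rho G :\: B| + 10 * #|G| <= D * #|G|)%N.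
have P0 : P finset.set0.
  rewrite /P cards0 /= muln0 addn0 muln0 leqn0 cards_eq0 -finset.subset0.
  by apply/fintype.subsetP => y; rewrite finset.in_setD => /andP[_ /slot_nbhdP[c [k []]]];
    rewrite inE.
have [G /andP[Gt GB] Gmax] := @arg_maxnP _ finset.set0 P (fun G : {set C} => #|G|) P0.
exists G; split.
  have h1 := expD G Gt.
  have h2 : (#|slot_nbhd rho G| <= #|slot_nbhd rho G :\: B| + #|B|)%N.
    rewrite -(cardsID B (slot_nbhd rho G)) addnC leq_add2l.
    by apply/subset_leq_card/subsetIr.
  by move: h1 h2 GB; move: (#|_|) (#|_|) (#|_|) (#|_|); nia.
move=> S StG dSG; set X := slot_nbhd rho S :\: _.
have [->|[c cS]] := set_0Vmem S; first by rewrite cards0 muln0.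
have cSG : #|S :|: G| = (#|S| + #|G|)%N.
  by rewrite -cardsUI (disjoint_setI0 dSG) cards0 addn0.
have S0 : (0 < #|S|)%N by apply/card_gt0P; exists c.
have nP : ~~ P (S :|: G).
  by apply/negP => /Gmax; rewrite /= cSG; move: S0; move: #|S| #|G|; lia.
have cN : (#|slot_nbhd rho (S :|: G) :\: B| <= #|X| + #|slot_nbhd rho G :\: B|)%N.
  apply: leq_trans (leq_card_setU _ _); apply/subset_leq_card/fintype.subsetP => y.
  rewrite finset.in_setU !finset.in_setD finset.in_setU negb_or => /andP[->
    /slot_nbhdP[c' [k [+ e]]]] /=.
  rewrite finset.in_setU ?andbT => /orP[] cS'; last first.
    by apply/orP; right; apply/slot_nbhdP; exists c', k.
  case: (boolP (y \in slot_nbhd rho G)) => //= _; rewrite ?orbT // orbF.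
  by apply/slot_nbhdP; exists c', k.
move: nP; rewrite /P cSG StG /= -ltnNge.
by move: GB cN; move: (#|_|) (#|_|) (#|_|) (#|_|) (#|_|); nia.
Qed.

(** * Matrices given by slots, and Euclidean norms *)

Definition slot_mx (R : realType) (m n D : nat) (rho : 'I_n -> 'I_D -> 'I_m)
    (s : 'I_n -> 'I_D -> R) : 'M[R]_(m, n) :=
  \matrix_(r, c) \sum_(k | rho c k == r) s c k.

Lemma slot_mxE (R : realType) (m n D : nat) (rho : 'I_n -> 'I_D -> 'I_m)
    (s : 'I_n -> 'I_D -> R) (x : 'cV[R]_n) (r : 'I_m) :
  (slot_mx rho s *m x) r 0 =
    \sum_(ck : 'I_n * 'I_D | rho ck.1 ck.2 == r) s ck.1 ck.2 * x ck.1 0.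
Proof.
rewrite mxE -(pair_big_dep xpredT (fun c k => rho c k == r) (fun c k => s c k * x c 0)) /=.
by apply: eq_bigr => c _; rewrite mxE mulr_suml.
Qed.

Lemma slot_mx_l1_le (R : realType) (m n D : nat) (rho : 'I_n -> 'I_D -> 'I_m)
    (s : 'I_n -> 'I_D -> R) (x : 'cV[R]_n) : (forall c k, `|s c k| = 1) ->
  \sum_r `|(slot_mx rho s *m x) r 0| <= D%:R * \sum_c `|x c 0|.
Proof.
move=> s1; have <- : \sum_(ck : 'I_n * 'I_D) `|x ck.1 0| = D%:R * \sum_c `|x c 0|.
  rewrite -(pair_bigA _ (fun c (_ : 'I_D) => `|x c 0|)) /= mulr_sumr.
  by apply: eq_bigr => c _; rewrite sumr_const card_ord mulr_natl.
rewrite (partition_big (fun ck : 'I_n * 'I_D => rho ck.1 ck.2) xpredT) //=.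
apply: ler_sum => r _; rewrite slot_mxE; apply: le_trans (ler_norm_sum _ _ _) _.
by apply: ler_sum => ck _; rewrite normrM s1 mul1r.
Qed.

Lemma sqr_l2norm (R : realType) (n : nat) (x : 'cV[R]_n) :
  l2norm x ^+ 2 = \sum_i x i 0 ^+ 2.
Proof. by rewrite sqr_sqrtr // sumr_ge0 // => i _; exact: sqr_ge0. Qed.

Lemma l2norm_ge0 (R : realType) (n : nat) (x : 'cV[R]_n) : 0 <= l2norm x.
Proof. exact: sqrtr_ge0. Qed.

Lemma l2norm_le_l1 (R : realType) (n : nat) (x : 'cV[R]_n) :
  l2norm x <= \sum_i `|x i 0|.
Proof.
have h : 0 <= \sum_i `|x i 0| by apply: sumr_ge0.
rewrite -(ler_pXn2r (n := 2)) // ?nnegrE ?l2norm_ge0 // sqr_l2norm expr2 mulr_suml.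
apply: ler_sum => i _; rewrite -real_normK ?num_real // expr2 ler_wpM2l //.
by rewrite (bigD1 i) //= lerDl sumr_ge0.
Qed.

Lemma l1_le_l2norm (R : realType) (n : nat) (x : 'cV[R]_n) :
  \sum_i `|x i 0| <= Num.sqrt n%:R * l2norm x.
Proof.
case: n x => [|n] x; first by rewrite big_ord0 mulr_ge0 ?sqrtr_ge0.
set S := \sum_i _.
have S0 : 0 <= S by apply: sumr_ge0.
rewrite -(ler_pXn2r (n := 2)) // ?nnegrE ?mulr_ge0 ?sqrtr_ge0 //.
rewrite exprMn sqr_sqrtr // sqr_l2norm.
have n0 : 0 < n.+1%:R :> R by rewrite ltr0n.
(* Cauchy-Schwarz, as nonnegativity of the scaled variance of the absolute values. *)
have : 0 <= \sum_(i < n.+1) (n.+1%:R * `|x i 0| - S) ^+ 2.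
  by apply: sumr_ge0 => i _; exact: sqr_ge0.
have -> : \sum_(i < n.+1) (n.+1%:R * `|x i 0| - S) ^+ 2 =
    n.+1%:R * (n.+1%:R * (\sum_i x i 0 ^+ 2) - S ^+ 2).
  transitivity (\sum_(i < n.+1) (n.+1%:R ^+ 2 * x i 0 ^+ 2 + (- (2 * n.+1%:R * S)) * `|x
    i 0| + S ^+ 2)).
    by apply: eq_bigr => i _; rewrite -[x i 0 ^+ 2]real_normK ?num_real //; ring.
  rewrite !big_split /= -!mulr_sumr sumr_const card_ord -/S -mulr_natl; ring.
by rewrite pmulr_rge0 // subr_ge0.
Qed.

(** Unlike [rows_in], this keeps the dimension, so that the matrix can still be applied. *)
Definition zero_outside (R : realType) (n : nat) (S : {set 'I_n}) (x : 'cV[R]_n) :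
  'cV[R]_n :=
  \col_i (if i \in S then x i 0 else 0).

Lemma l2norm_rows_in (R : realType) (n : nat) (S : {set 'I_n}) (x : 'cV[R]_n) :
  l2norm (rows_in S x) = l2norm (zero_outside S x).
Proof.
congr Num.sqrt; under [RHS]eq_bigr do rewrite mxE.
rewrite [RHS](bigID (fun i => i \in S)) /= [X in _ + X]big1 ?addr0; last first.
  by move=> i /negPf ->; rewrite expr0n.
rewrite [RHS](eq_bigr (fun i => x i 0 ^+ 2)); last by move=> i ->.
by rewrite [RHS]big_enum_val /=; apply: eq_bigr => k _; rewrite mxE.
Qed.

Lemma rows_in_mul (R : realType) (m n : nat) (S : {set 'I_m}) (A : 'M[R]_(m, n))
    (x : 'cV[R]_n) : rows_in S A *m x = rows_in S (A *m x).
Proof. by apply/matrixP => i j; rewrite !mxE; apply: eq_bigr => k _; rewrite !mxE. Qed.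

Lemma slot_mx_l1_ge (R : realType) (m n D E : nat) (rho : 'I_n -> 'I_D -> 'I_m)
    (Z : {set 'I_m}) (s : 'I_n -> 'I_D -> R) (x : 'cV[R]_n) :
  (forall c k, `|s c k| = 1) ->
  (forall S : {set 'I_n}, (forall c, c \in S -> x c 0 != 0) ->
     (E * #|S| <= #|slot_nbhd rho S :\: Z|)%N) ->
  (2 * E%:R - D%:R) * (\sum_c `|x c 0|) <=
    \sum_(r | r \notin Z) `|(slot_mx rho s *m x) r 0|.
Proof.
move=> s1 exp; under [leRHS]eq_bigr do rewrite slot_mxE.
exact: (slot_l1_lower_bound s1 exp).
Qed.

(** If the part of [x] off [S] were too small, [M] would send the part on [S] to the difference of
    two small vectors: the images of [x - v], with [v] in the kernel, and of the part off [S].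
    Expansion then makes the part on [S] small too, against Pythagoras. *)
Lemma near_kernel_not_sparse (R : realType) (m n tau : nat)
    (rho : 'I_n -> 'I_40 -> 'I_m) (s : 'I_n -> 'I_40 -> R) (x : 'cV[R]_n)
    (S : {set 'I_n}) :
  (25 <= n)%N -> (forall c k, `|s c k| = 1) ->
  (forall T : {set 'I_n}, #|T| <= tau -> 40 * #|T| <= #|slot_nbhd rho T| + 5 * #|T|)%N ->
  (#|S| <= tau)%N ->
  l2dist x (col_kernel (slot_mx rho s)) <= l2norm x / (12 * Num.sqrt n%:R) ->
  l2norm x / (2 * Num.sqrt n%:R) <= l2norm (rows_in (~: S) x).
Proof.
move=> n25 s1 exp St dx; rewrite l2norm_rows_in.
set q := Num.sqrt n%:R in dx *; set X := l2norm x in dx *; set M := slot_mx rho s in dx *.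
have q5 : 5 <= q.
  have -> : 5 = Num.sqrt (5 ^+ 2) :> R by rewrite sqrtr_sqr ger0_norm.
  by rewrite ler_wsqrtr // -natrX ler_nat.
have q0 : 0 < q by lra.
have X0 : 0 <= X by exact: l2norm_ge0.
rewrite leNgt; apply/negP => hC; set c := l2norm _ in hC.
have c0 : 0 <= c by exact: l2norm_ge0.
have Xp : 0 < X.
  have : 0 < X / (2 * q) by exact: le_lt_trans hC.
  by rewrite pmulr_lgt0 // invr_gt0 mulr_gt0.
(* A near-minimiser suffices: its slack is [X / (60 * q)], and 1/12 + 1/60 = 1/10. *)
have [v Mv hv] : exists2 v, M *m v = 0 & q * l2norm (x - v) <= X / 10.
  have hi : has_inf [set l2norm (x - v) | v in col_kernel M]%classic.
    split; first by exists (l2norm (x - 0)), 0 => //; rewrite /col_kernel /= mulmx0.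
    by exists 0 => _ [v _ <-]; exact: l2norm_ge0.
  have e0 : 0 < X / (60 * q) by rewrite divr_gt0 // mulr_gt0.
  have [_ [v Mv <-] hv] := inf_adherent e0 hi.
  exists v => //; rewrite -/(l2dist _ _) in hv.
  have : l2norm (x - v) <= X / (12 * q) + X / (60 * q) by rewrite (le_trans (ltW hv)) //
    lerD2r.
  have -> : X / (12 * q) + X / (60 * q) = X / 10 / q by field; rewrite gt_eqF.
  by rewrite ler_pdivlMr // mulrC.
have xE : x = zero_outside S x + zero_outside (~: S) x.
  by apply/colP => i; rewrite !mxE inE; case: ifP; rewrite /= ?addr0 ?add0r.
have h30 : 30 * (\sum_i `|zero_outside S x i 0|) <= \sum_r `|(M *m zero_outside S x) r 0|.
  apply: (@le_trans _ _ (\sum_(r | r \notin finset.set0) `|(M *m zero_outside S x) r 0|));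
    last first.
    by rewrite big_mkcond; apply: ler_sum => r _; case: ifP.
  rewrite (_ : 30 = 2 * 35%:R - 40%:R); last by ring.
  apply: (slot_mx_l1_ge s1) => T TS; rewrite finset.setD0.
  have : (#|T| <= tau)%N.
    apply: leq_trans St; apply/subset_leq_card/fintype.subsetP => i /TS; rewrite mxE.
    by case: ifP => //; rewrite eqxx.
  by move/exp; move: (#|_|) (#|_|); lia.
have MS : M *m zero_outside S x = M *m (x - v) - M *m zero_outside (~: S) x.
  by rewrite mulmxBr Mv subr0 {2}xE mulmxDr addrK.
have h40 : \sum_r `|(M *m zero_outside S x) r 0| <= 40 * (q * l2norm (x - v)) + 40 * (q *
  c).
  have l1 := le_trans (slot_mx_l1_le rho (x - v) s1) (ler_wpM2l (ler0n _ _) (l1_le_l2norm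
    (x - v))).
  have l2 := le_trans (slot_mx_l1_le rho (zero_outside (~: S) x) s1) (ler_wpM2l (ler0n _
    _) (l1_le_l2norm (zero_outside (~: S) x))).
  apply: le_trans (lerD l1 l2); rewrite -big_split; apply: ler_sum => r _ /=.
  by rewrite MS mxE [X in _ + X]mxE ler_normB.
have hqc : q * c <= X / 2.
  rewrite (le_trans (ler_wpM2l (ltW q0) (ltW hC))) // le_eqVlt; apply/orP; left; apply/eqP.
  by field; rewrite gt_eqF.
have ha := l2norm_le_l1 (zero_outside S x).
have a0 := l2norm_ge0 (zero_outside S x).
have pyth : X ^+ 2 = l2norm (zero_outside S x) ^+ 2 + c ^+ 2.
  rewrite /X /c !sqr_l2norm -big_split; apply: eq_bigr => i _ /=; rewrite !mxE inE.
  by case: ifP; rewrite /= expr0n ?addr0 ?add0r.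
(* Here [30 * a <= 40 * (X / 10 + X / 2)] bounds the part on [S] by 4/5 of [X], and [q5] bounds [c]
   by 1/10 of [X]; the squares sum to less than [X ^+ 2]. *)
have cX : 10 * c <= X by nra.
nra.
Qed.

(** A row that no column of [C] meets cannot tell [x] from its part off [C], so the expansion of
    that part is visible in [M *m x]. Expansion is required up to [2 * t] because [C] is adjoined to
    a support of fewer than [t] columns. *)
Lemma robust_sparse_recovery (R : realType) (m n t : nat)
    (rho : 'I_n -> 'I_40 -> 'I_m) (s : 'I_n -> 'I_40 -> R) (B : {set 'I_m}) :
  (m <= n)%N -> (forall c k, `|s c k| = 1) ->
  (forall T : {set 'I_n}, #|T| <= 2 * t -> 40 * #|T| <= #|slot_nbhd rho T| + 5 * #|T|)%N ->
  (#|B| <= t)%N ->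
  exists C : {set 'I_n}, (#|C| <= 2 * #|B|)%N /\
    forall x : 'cV[R]_n,
      l2norm (rows_in (~: C) x) <= n%:R * l2norm (rows_in (~: B) (slot_mx rho s) *m x) \/
      (t <= l0norm x)%N.
Proof.
move=> mn s1 exp Bt; have [C [CB hC]] := exists_absorbing_set B exp.
exists C; split=> [|x]; first by lia.
have [tx|xt] := leqP t (l0norm x); [by right | left].
rewrite l2norm_rows_in rows_in_mul; set M := slot_mx rho s.
set y := zero_outside (~: C) x.
have h20 : 20 * (\sum_i `|y i 0|) <= \sum_(r | r \notin B :|: slot_nbhd rho C) `|(M *m y)
  r 0|.
  rewrite (_ : 20 = 2 * 30%:R - 40%:R); last by ring.
  apply: (slot_mx_l1_ge s1) => T Ty.
  have cT : (#|T| <= l0norm x)%N.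
    rewrite -(card_imset (f := fun i : 'I_n => (i, 0 : 'I_1))) => [|i j [] //].
    apply/subset_leq_card/fintype.subsetP => _ /imsetP[i iT ->]; rewrite inE /=.
    by have := Ty i iT; rewrite mxE; case: ifP => //; rewrite eqxx.
  have dT : [disjoint T & C].
    rewrite finset.disjoints_subset; apply/fintype.subsetP => i /Ty; rewrite mxE.
    by case: ifP => //; rewrite eqxx.
  have TC : (#|T| + #|C| <= 2 * t)%N by lia.
  have := hC T TC dT; move: (#|_|) (#|_|); lia.
have hMy r : r \notin B :|: slot_nbhd rho C -> (M *m y) r 0 = (M *m x) r 0.
  rewrite finset.in_setU negb_or => /andP[_ rC]; rewrite !slot_mxE;
    apply: eq_bigr => -[c k] /= /eqP e.
  rewrite mxE inE; case: ifP => // /negbFE cC; case/negP: rC.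
  by apply/slot_nbhdP; exists c, k.
have hB : \sum_(r | r \notin B :|: slot_nbhd rho C) `|(M *m y) r 0| <=
    \sum_k `|rows_in (~: B) (M *m x) k 0|.
  rewrite (eq_bigr _ (fun r hr => congr1 Num.norm (hMy r hr))).
  apply: (@le_trans _ _ (\sum_(r in ~: B) `|(M *m x) r 0|)).
    rewrite big_mkcond [leRHS]big_mkcond; apply: ler_sum => r _.
    rewrite finset.in_setU negb_or finset.in_setC.
    by case: (r \in B); case: (r \in slot_nbhd rho C) => /=.
  rewrite [leLHS]big_enum_val; apply: ler_sum => k _; by rewrite [in leRHS]mxE.
have hl := l1_le_l2norm (rows_in (~: B) (M *m x)).
have hy := l2norm_le_l1 y.
have hn : Num.sqrt #|~: B|%:R <= n%:R :> R.
  have Bn : (#|~: B| <= n)%N by rewrite (leq_trans (max_card _)) // card_ord.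
  rewrite -[leRHS]ger0_norm // -sqrtr_sqr ler_wsqrtr // -natrX ler_nat.
  by rewrite (leq_trans Bn) //; case: (n) => // n'; rewrite leq_pmulr.
have l0 := l2norm_ge0 (rows_in (~: B) (M *m x)).
have y0 := l2norm_ge0 y.
nra.
Qed.

(** * Spectrum of the Gram matrix *)

(** Over the complex numbers [A] is Hermitian, and its unitary diagonalisation has a real diagonal.
    A finite list of eigenvalues, not all zero, is what the existence of a smallest nonzero one
    requires. *)
Lemma symmetric_real_spectrum (R : rcfType) (n : nat) (A : 'M[R]_n) : A^T = A ->
  exists d : 'I_n -> R, (forall mu, eigenvalue A mu <-> exists i, d i = mu) /\
    (A != 0 -> exists i, d i != 0).
Proof.
move=> Asym.
pose Ac := map_mx (real_complex R) A.
have Acsym : Ac \is symmetricmx.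
  by apply/is_hermitianmxP; rewrite expr0 scale1r map_mx_id // /Ac map_trmx Asym.
have Acreal : Ac \is a realmx.
  by apply/mxOverP => i j; rewrite mxE complex_real.
have Acn := symmetric_normalmx Acsym Acreal.
have dreal := hermitian_spectral_diag_real (realsym_hermsym Acsym Acreal).
set P := spectralmx Ac; set D := spectral_diag Ac in dreal.
have AcE : Ac = invmx P *m diag_mx D *m P by exact/orthomx_spectralP.
have Pu : P \in unitmx by exact: spectral_unit.
pose d i := complex.Re (D 0 i).
have dE i : real_complex R (d i) = D 0 i by apply: RRe_real; exact: (mxOverP dreal).
have eigE mu : eigenvalue A mu = eigenvalue Ac (real_complex R mu).
  by rewrite /Ac eigenvalue_map.
exists d; split=> [mu|A0].
  rewrite eigE; split=> [/eigenvalueP[v vA v0]|[i <-]].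
    have w0 : v *m invmx P != 0.
      by apply: contra v0 => /eqP e; rewrite -(mulmxKV Pu v) e mul0mx.
    have [i wi] : exists i, (v *m invmx P) 0 i != 0.
      by apply/existsP; apply: contraR w0; rewrite negb_exists => /forallP h;
         apply/eqP/rowP => i; rewrite [RHS]mxE; apply/eqP; have := h i; rewrite negbK.
    exists i; apply: complexI; rewrite dE; apply: (mulIf wi).
    have := congr1 (fun u => (u *m invmx P) 0 i) vA.
    by rewrite AcE !mulmxA mulmxK // mul_mx_diag -scalemxAl !mxE mulrC.
  apply/eigenvalueP; exists (row i P).
    rewrite -row_mul AcE !mulmxA mulmxV // mul1mx.
    by apply/rowP => j; rewrite mul_diag_mx !mxE dE.
  apply: contraTneq Pu => e; apply/negP => Pu.
  have := congr1 (fun u => (u *m invmx P) 0 i) e.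
  by rewrite -row_mul mulmxV // mul0mx !mxE eqxx => /eqP; rewrite oner_eq0.
apply/existsP; apply: contraR A0; rewrite negb_exists => /forallP h.
have D0 : D = 0.
  by apply/rowP => i; rewrite [RHS]mxE -dE; have := h i; rewrite negbK => /eqP ->;
    rewrite rmorph0.
have : Ac == 0 by rewrite AcE D0 raddf0 mulmx0 mul0mx.
by rewrite map_mx_eq0.
Qed.

(** At an eigenvector the squares of the two sides are [mu] and [mu ^+ 2] times the squared norm of
    [x], so a nonzero [mu] is at least 1. *)
Lemma smallest_nonzero_eigenvalue_ge1 (R : realType) (m n : nat) (M : 'M[R]_(m, n)) :
  M != 0 ->
  (forall x : 'cV[R]_n, l2norm (M *m x) <= l2norm (M^T *m (M *m x))) ->
  exists lambda, smallest_nonzero_eigenvalue (M^T *m M) lambda /\ 1 <= lambda.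
Proof.
move=> M0 hM; set A := M^T *m M.
have Asym : A^T = A by rewrite trmx_mul trmxK.
have dot_sqr k (u : 'cV[R]_k) : (u^T *m u) 0 0 = l2norm u ^+ 2.
  by rewrite sqr_l2norm mxE; apply: eq_bigr => i _; rewrite mxE expr2.
have l20 k (u : 'cV[R]_k) : l2norm u = 0 -> u = 0.
  move=> u0; apply/colP => i; rewrite mxE.
  have := l1_le_l2norm u; rewrite u0 mulr0 => h; apply/eqP; rewrite -normr_le0.
  by apply: le_trans h; rewrite (bigD1 i) //= lerDl sumr_ge0.
have eig1 mu : eigenvalue A mu -> mu != 0 -> 1 <= mu.
  move=> /eigenvalueP[v vA v0] mu0; set x := v^T.
  have Ax : A *m x = mu *: x by rewrite -Asym -trmx_mul vA linearZ.
  have x0 : 0 < l2norm x.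
    rewrite lt_neqAle l2norm_ge0 andbT eq_sym; apply: contra v0 => /eqP/l20 e.
    by rewrite -(trmxK v) -/x e trmx0.
  have e1 : l2norm (M *m x) ^+ 2 = mu * l2norm x ^+ 2.
    by rewrite -!dot_sqr trmx_mul -mulmxA (mulmxA M^T) -/A Ax -scalemxAr mxE.
  have e2 : l2norm (M^T *m (M *m x)) ^+ 2 = mu ^+ 2 * l2norm x ^+ 2.
    rewrite mulmxA -/A Ax !sqr_l2norm mulr_sumr; apply: eq_bigr => i _.
    by rewrite mxE exprMn.
  have h : l2norm (M *m x) ^+ 2 <= l2norm (M^T *m (M *m x)) ^+ 2.
    by rewrite ler_pXn2r ?nnegrE ?l2norm_ge0.
  have x2 : 0 < l2norm x ^+ 2 by rewrite exprn_gt0.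
  have p : 0 <= mu by rewrite -(pmulr_lge0 _ x2) -e1 exprn_ge0 // l2norm_ge0.
  move: h; rewrite e1 e2 ler_pM2r // expr2 -{1}[mu]mulr1 ler_pM2l //.
  by rewrite lt_neqAle eq_sym mu0.
have A0 : A != 0.
  apply: contra M0 => /eqP A0; apply/eqP/matrixP => i j.
  have /colP/(_ i) : col j M = 0; last by rewrite !mxE.
  rewrite colE; apply/l20/le_anti; rewrite l2norm_ge0 andbT (le_trans (hM _)) //.
  rewrite mulmxA -/A A0 mul0mx (le_trans (l2norm_le_l1 _)) // big1 // => k _.
  by rewrite mxE normr0.
have [d [dE dn]] := symmetric_real_spectrum Asym.
have [i0 di0] := dn A0.
have [i di imin] := arg_minP d (di0 : [pred i | d i != 0] i0).
exists (d i); split; last by apply: eig1 => //; apply/dE; exists i.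
split=> //; first by apply/dE; exists i.
by move=> mu /dE[j <-] dj; apply: imin.
Qed.

(** Columns have l1 norm at most [D], so each of the [n ^ 2] Gram entries is at most [D ^ 2] in
    absolute value. *)
Lemma frobenius_gram_le (R : realType) (m n D : nat) (rho : 'I_n -> 'I_D -> 'I_m)
    (s : 'I_n -> 'I_D -> R) : (forall c k, `|s c k| = 1) ->
  frobenius_norm ((slot_mx rho s)^T *m slot_mx rho s) <= n%:R * D%:R ^+ 2.
Proof.
move=> s1; set M := slot_mx rho s.
have colsum c : \sum_r `|M r c| <= D%:R.
  have -> : D%:R = \sum_(k < D) 1 :> R by rewrite sumr_const card_ord.
  rewrite (partition_big (rho c) xpredT) //=; apply: ler_sum => r _.
  by rewrite mxE (le_trans (ler_norm_sum _ _ _)) //; apply: ler_sum => k _; rewrite s1.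
have entry c c' : (M^T *m M) c c' ^+ 2 <= (D%:R ^+ 2) ^+ 2.
  rewrite -real_normK ?num_real // ler_pXn2r ?nnegrE ?exprn_ge0 // mxE.
  apply: le_trans (ler_norm_sum _ _ _) _; rewrite expr2.
  apply: (@le_trans _ _ ((\sum_r `|M r c|) * D%:R)); last by rewrite ler_wpM2r.
  rewrite mulr_suml; apply: ler_sum => r _; rewrite mxE normrM ler_wpM2l //.
  by apply: le_trans (colsum c'); rewrite (bigD1 r) //= lerDl sumr_ge0.
have h : 0 <= n%:R * D%:R ^+ 2 :> R by rewrite mulr_ge0 ?exprn_ge0.
rewrite -[leRHS]ger0_norm // -sqrtr_sqr ler_wsqrtr //.
have -> : (n%:R * D%:R ^+ 2) ^+ 2 = \sum_(c < n) \sum_(c' < n) (D%:R ^+ 2) ^+ 2 :> R.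
  by rewrite !sumr_const card_ord -mulrnA -[RHS]mulr_natl natrM; ring.
by apply: ler_sum => c _; apply: ler_sum => c' _; exact: entry.
Qed.

Lemma l0norm_row_slot_mx (R : realType) (m n D : nat) (rho : 'I_n -> 'I_D -> 'I_m)
    (s : 'I_n -> 'I_D -> R) (r : 'I_m) :
  (l0norm (row r (slot_mx rho s)) <= #|[set c | [exists k, rho c k == r]]|)%N.
Proof.
rewrite -(card_imset (f := fun c : 'I_n => (0 : 'I_1, c))) => [|i j [] //].
apply/subset_leq_card/fintype.subsetP => -[i c]; rewrite inE /= !mxE => h.
rewrite ord1; apply: imset_f; rewrite inE; apply: contraR h;
  rewrite negb_exists => /forallP h.
by rewrite big1 // => k hk; have := h k; rewrite hk.
Qed.

(** In each slot the block columns go to distinct rows, and [psi] adds at most two further columns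
    per row. *)
Lemma card_block_slot_row (p a d : nat) (pi : 'I_d -> {perm 'I_p})
    (psi : 'I_a -> bool * 'I_p) (P : 'I_d.+1 -> {perm 'I_a}) (y : bool * 'I_p) :
  (forall y, #|[set x | psi x == y]| <= 2)%N ->
  (#|[set c | [exists k, block_slot pi psi P c k == y]]| <= 3 * d.+1)%N.
Proof.
move=> psi2; pose E k := [set c | block_slot pi psi P c k == y].
apply: (@leq_trans (\sum_(k < d.+1) #|E k|)).
  by apply: card_le_cover => c; rewrite inE => /existsP[k hk]; exists k; rewrite // inE.
rewrite mulnC -[X in (X * 3)%N]card_ord -sum_nat_const; apply: leq_sum => k _.
rewrite card_sum_set -[3%N]/(1 + 2)%N; apply: leq_add.
  apply/card_le1P => u; rewrite !inE => /eqP eu v; rewrite !inE.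
  apply/eqP/eqP => [|-> //]; rewrite -eu /=.
  case: unliftP => [k' _|_] //=; case: u {eu} => b i; case: v => b' i' [] /=.
  by case: b; case: b' => //= _ /perm_inj ->.
apply: leq_trans (psi2 y); rewrite -(card_preimset [set x | psi x == y] (@perm_inj _ (P
  k))).
by apply/subset_leq_card/fintype.subsetP => x; rewrite !inE.
Qed.

(** The inner sum is the entry at [c] of the transposed matrix applied to [z]. Over the block
    columns the antisymmetric terms cancel in the inner product of [z] and [w], and expanding the
    squared norm of [w - z] gives the bound; the other columns only add squares. *)
Lemma block_coercive (R : realType) (p a d : nat) (pi : 'I_d -> {perm 'I_p})
    (psi : 'I_a -> bool * 'I_p) (P : 'I_d.+1 -> {perm 'I_a}) (z : bool * 'I_p -> R) :
  \sum_y z y ^+ 2 <=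
    \sum_(c : bool * 'I_p + 'I_a)
      (\sum_k (-1) ^+ block_sign c k * z (block_slot pi psi P c k)) ^+ 2.
Proof.
pose w c := \sum_k (-1) ^+ block_sign c k * z (block_slot pi psi P c k).
rewrite big_sumType /= -[leLHS]addr0 lerD ?sumr_ge0 // => [|x _]; last exact: sqr_ge0.
pose h b i := \sum_(k < d) z (~~ b, if b then (pi k)^-1%g i else pi k i).
have wE b i : w (inl (b, i)) = z (b, i) + (-1) ^+ b * h b i.
  rewrite /w big_ord_recl /= unlift_none; congr (_ + _).
    by case: b; rewrite expr0 mul1r.
  rewrite mulr_sumr; apply: eq_bigr => k _; rewrite liftK /=.
  by case: b.
have zw : \sum_bi z bi * w (inl bi) = \sum_bi z bi ^+ 2.
  have antisym : \sum_i z (true, i) * h true i = \sum_i z (false, i) * h false i.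
    under eq_bigr do rewrite mulr_sumr; under [RHS]eq_bigr do rewrite mulr_sumr.
    rewrite exchange_big [RHS]exchange_big /=; apply: eq_bigr => k _.
    rewrite (reindex_inj (@perm_inj _ (pi k))) /=; apply: eq_bigr => i _.
    by rewrite permK mulrC.
  have pairE (F : bool * 'I_p -> R) : \sum_bi F bi = \sum_i F (true, i) + \sum_i F
    (false, i).
    by rewrite -(big_bool _ (fun b => \sum_i F (b, i))) pair_bigA; apply: eq_bigr => -[].
  rewrite !pairE.
  under eq_bigr do rewrite wE mulrDr expr1 mulN1r mulrN -expr2.
  under [X in _ + X = _]eq_bigr do rewrite wE mulrDr expr0 mul1r -expr2.
  by rewrite sumrB big_split /= antisym addrACA addNr addr0.
have : 0 <= \sum_bi (w (inl bi) - z bi) ^+ 2 by apply: sumr_ge0 => bi _; exact: sqr_ge0.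
have -> : \sum_bi (w (inl bi) - z bi) ^+ 2 =
    \sum_bi w (inl bi) ^+ 2 - 2 * (\sum_bi z bi * w (inl bi)) + \sum_bi z bi ^+ 2.
  rewrite mulr_sumr -sumrB -big_split /=; apply: eq_bigr => bi _; ring.
rewrite zw /w; lra.
Qed.

(** * Assembly of the matrix for every large even dimension *)

Lemma exists_expanding_slots (R : realType) (n m p a d tau K : nat) :
  (0 < p)%N -> (0 < d)%N -> (2 * p <= a)%N -> (a <= 4 * p)%N ->
  n = (2 * p + a)%N -> (2 * p <= m)%N -> (256 * 8 ^ d.+1 * d.+1 ^ 2 = K)%N -> (K * tau <=
    p)%N ->
  exists (rho : 'I_n -> 'I_d.+1 -> 'I_m) (s : 'I_n -> 'I_d.+1 -> R),
    [/\ forall c k, `|s c k| = 1,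
        forall S : {set 'I_n}, (#|S| <= tau)%N ->
          (d.+1 * #|S| <= #|slot_nbhd rho S| + 5 * #|S|)%N,
        forall r, (#|[set c | [exists k, rho c k == r]]| <= 3 * d.+1)%N &
        forall x, l2norm (slot_mx rho s *m x) <=
          l2norm ((slot_mx rho s)^T *m (slot_mx rho s *m x))].
Proof.
move=> p0 d0 pa ap nE pm <- Ktau.
have [pi [psi [P [psi2 exp]]]] := exists_expanding_blocks p0 d0 pa ap Ktau.
pose Col := (bool * 'I_p + 'I_a)%type.
have cCol : n = #|{: Col}| by rewrite card_sum card_prod card_bool !card_ord.
have cRow : (#|{: bool * 'I_p}| <= m)%N by rewrite card_prod card_bool card_ord.
pose f (c : 'I_n) : Col := enum_val (cast_ord cCol c).
pose f' (c : Col) : 'I_n := cast_ord (esym cCol) (enum_rank c).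
have fK : cancel f f' by move=> c; rewrite /f /f' enum_valK cast_ordK.
have f'K : cancel f' f by move=> c; rewrite /f /f' cast_ordKV enum_rankK.
pose g (y : bool * 'I_p) : 'I_m := widen_ord cRow (enum_rank y).
have g_inj : injective g.
  by move=> y y' /(congr1 val) /= e; apply/enum_rank_inj/val_inj.
pose rho c k := g (block_slot pi psi P (f c) k).
pose s c (k : 'I_d.+1) : R := (-1) ^+ block_sign (f c) k.
exists rho, s; split.
- by move=> c k; rewrite /s normrX normrN1 expr1n.
- move=> S cS; have := exp (f @: S); rewrite (card_imset _ (can_inj fK)) => /(_ cS).
  suff -> : slot_nbhd rho S = g @: slot_nbhd (block_slot pi psi P) (f @: S).
    by rewrite (card_imset _ g_inj).
  apply/setP => r; apply/slot_nbhdP/imsetP => [[c [k [cS' <-]]]|[y /slot_nbhdP[c' [k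
    [/imsetP[c cS' ->] <-]]] ->]].
    exists (block_slot pi psi P (f c) k) => //; apply/slot_nbhdP; exists (f c), k;
      split=> //.
    exact: imset_f.
  by exists c, k.
- move=> r; have [/existsP[y /eqP <-]|] := boolP [exists y, g y == r].
    apply: leq_trans (card_block_slot_row pi P y psi2);
      rewrite -(card_imset _ (can_inj fK)).
    apply/subset_leq_card/fintype.subsetP => _ /imsetP[c + ->];
      rewrite !inE => /existsP[k /eqP/g_inj e].
    by apply/existsP; exists k; rewrite e.
  rewrite negb_exists => /forallP gr; rewrite (_ : [set c | _] = finset.set0) ?cards0 //.
  apply/setP => c; rewrite !inE; apply/negbTE; rewrite negb_exists; apply/forallP => k.
  exact: gr.
- move=> x; set y := slot_mx rho s *m x.
  (* A row outside the image of [g] is zero, which is why coercivity is claimed only for [y] in the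
     range of the matrix. *)
  have y0 r : (forall z, g z != r) -> y r 0 = 0.
    by move=> gr; rewrite /y slot_mxE big1 // => -[c k] /= hr;
      have := gr (block_slot pi psi P (f c) k); rewrite -/(rho c k) hr.
  clearbody y; have -> : l2norm y = Num.sqrt (\sum_z y (g z) 0 ^+ 2).
    congr Num.sqrt; rewrite (bigID (fun r => r \in codom g)) /= [X in _ + X]big1 ?addr0;
      last first.
      by move=> r hr; rewrite y0 ?expr0n // => z; apply: contraNneq hr => <-;
        exact: codom_f.
    have ug : uniq (codom g) by rewrite map_inj_uniq // enum_uniq.
    by rewrite -(big_uniq _ ug) big_image.
  rewrite ler_wsqrtr // (le_trans (block_coercive pi psi P (fun z => y (g z) 0))) //.
  rewrite le_eqVlt; apply/orP; left; apply/eqP.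
  rewrite (reindex f) /=; last by exists f' => c _.
  apply: eq_bigr => c _; congr (_ ^+ 2).
  rewrite mxE; under [RHS]eq_bigr do rewrite !mxE mulr_suml.
  rewrite (exchange_big_dep xpredT) //=; apply: eq_bigr => k _.
  by rewrite (big_pred1 (rho c k)) // => r; rewrite eq_sym.
Qed.

(** Slots sharing a row might cancel; the l1 lower bound at a basis vector excludes that they all
    do. *)
Lemma slot_mx_neq0 (R : realType) (m n tau : nat) (rho : 'I_n -> 'I_40 -> 'I_m)
    (s : 'I_n -> 'I_40 -> R) :
  (0 < n)%N -> (0 < tau)%N -> (forall c k, `|s c k| = 1) ->
  (forall S : {set 'I_n}, #|S| <= tau -> 40 * #|S| <= #|slot_nbhd rho S| + 5 * #|S|)%N ->
  slot_mx rho s != 0.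
Proof.
case: n rho s => // n rho s _ tau0 s1 exp; apply/eqP => M0.
pose e := delta_mx 0 0 : 'cV[R]_n.+1.
have exp' (S : {set 'I_n.+1}) : (forall c, c \in S -> e c 0 != 0) ->
    (35 * #|S| <= #|slot_nbhd rho S :\: finset.set0|)%N.
  move=> S0; rewrite finset.setD0.
  have : (#|S| <= tau)%N.
    apply: leq_trans tau0; rewrite -(cards1 (0 : 'I_n.+1)).
    apply/subset_leq_card/fintype.subsetP => c /S0.
    by rewrite mxE inE; apply: contraNT => /negPf ->.
  by move/exp; move: (#|_|) (#|_|); lia.
have := slot_mx_l1_ge s1 exp'; rewrite M0 [leRHS]big1 => [|r _];
  last by rewrite mul0mx mxE normr0.
rewrite (bigD1 0) //= [e 0 0]mxE !eqxx /= normr1.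
have : 0 <= \sum_(i < n.+1 | i != 0) `|e i 0| by apply: sumr_ge0.
lra.
Qed.

Lemma exists_linear_expanding_slots (R : realType) :
  exists K, (0 < K)%N /\ forall n, (K <= n)%N -> ~~ odd n ->
    exists t (rho : 'I_n -> 'I_40 -> 'I_(n./2)) (s : 'I_n -> 'I_40 -> R),
    (n <= K * t)%N /\
    [/\ forall c k, `|s c k| = 1,
        forall S : {set 'I_n}, (#|S| <= 2 * t)%N ->
          (40 * #|S| <= #|slot_nbhd rho S| + 5 * #|S|)%N,
        forall r, (#|[set c | [exists k, rho c k == r]]| <= 120)%N &
        forall x, l2norm (slot_mx rho s *m x) <=
          l2norm ((slot_mx rho s)^T *m (slot_mx rho s *m x))].
Proof.
have pos a b c d e : (0 < a -> 0 < b -> 0 < d -> 0 < a * b ^ c * d ^ e)%N.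
  by move=> a0 b0 d0; rewrite !muln_gt0 !expn_gt0 a0 b0 d0.
have [K0 [K00 K0E]] : exists K0, (0 < K0)%N /\ (256 * 8 ^ 40 * 40 ^ 2 = K0)%N.
  by exists (256 * 8 ^ 40 * 40 ^ 2)%N; split; [exact: pos | reflexivity].
(* Up to rounding [n] is [8 * K0 * t]; doubling the factor absorbs the rounding, since [t] is
   positive for such [n]. *)
exists (16 * K0 + 100)%N; split=> [|n nK on]; first by lia.
pose p := n./2./2; pose t := (p %/ (2 * K0))%N.
have hp : (4 * p <= n <= 4 * p + 2)%N.
  by rewrite /p -!divn2; have := modn2 n; rewrite (negbTE on) /=; lia.
(* If [n] is 2 modulo 4, there are [2 * p + 1] rows, one of them zero, and [2 * p + 2] columns
   outside the block. *)
have [||||||||rho [s H]] := @exists_expanding_slots R n n./2 p (n - 2 * p) 39 (2 * t) K0.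
- lia.
- by [].
- lia.
- lia.
- lia.
- by rewrite /p -!divn2; lia.
- exact: K0E.
- by rewrite /t mulnA [(K0 * 2)%N]mulnC mulnC leq_divM.
exists t, rho, s; split=> //.
have := ltn_ceil p (_ : 0 < 2 * K0)%N; rewrite -/t muln_gt0 => /(_ K00).
by nia.
Qed.

Theorem theorem4p16 (R : realType) :
  exists (n0 : nat) (c_tau C_eta c_b C_row C_frob c_eig : R),
    (0 < c_tau /\ 0 < C_eta /\ 0 < c_b /\ 0 < C_row /\ 0 < C_frob /\ 0 < c_eig) /\
    forall n : nat, (n0 < n)%N -> ~~ odd n ->
    exists (tau eta b : R) (M : 'M[R]_(n./2, n)),
      let Theta : 'M[R]_n := M^T *m M in
      c_tau * (n%:R / ln n%:R ^+ 6) <= tau /\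
      (0 <= eta /\ eta <= C_eta * (n%:R ^+ 6 * ln n%:R ^+ 8)) /\
      c_b * (n%:R / ln n%:R ^+ 8) <= b /\
      (forall i : 'I_(n./2), sparse (C_row * ln n%:R ^+ 2) (row i M)) /\
      (forall (x : 'cV[R]_n) (S : {set 'I_n}),
         l2dist x (col_kernel M) <= l2norm x / (12 * Num.sqrt n%:R) ->
         #|S|%:R <= tau ->
         l2norm x / (2 * Num.sqrt n%:R) <= l2norm (rows_in (~: S) x)) /\
      (forall B : {set 'I_(n./2)}, #|B|%:R <= b ->
         exists C : {set 'I_n}, (#|C| <= 2 * #|B|)%N /\
         forall x : 'cV[R]_n,
           l2norm (rows_in (~: C) x) <= eta * l2norm (rows_in (~: B) M *m x) \/
           tau <= (l0norm x)%:R) /\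
      frobenius_norm Theta <= C_frob * (n%:R * ln n%:R) /\
      exists lambda : R, smallest_nonzero_eigenvalue Theta lambda /\
        c_eig * n%:R `^ (- (5 / 2)) <= lambda.
Proof.
have [K [K0 HK]] := exists_linear_expanding_slots R.
have [N hN] : exists N, expR 1 <= N%:R :> R.
  by exists (Num.bound (expR 1 : R)); rewrite ltW // archi_boundP // expR_ge0.
(* Beyond [N] the logarithm is at least 1, so its powers only help; 25 is what the estimate near the
   kernel needs, and 120 bounds the row sparsity. *)
exists (K + N + 25)%N, K%:R^-1, 1, K%:R^-1, 120, (40 ^+ 2), 1.
have Kp : 0 < K%:R^-1 :> R by rewrite invr_gt0 ltr0n.
have natp k : 0 < k.+1%:R :> R by rewrite ltr0n.
split; first exact: (conj Kp (conj ltr01 (conj Kp (conj (natp 119) (conj (exprn_gt0 2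
  (natp 39)) ltr01))))).
move=> n nn on; have [|t [rho [s [nt [s1 exp deg coer]]]]] := HK n _ on; first by lia.
have n1 : 1 <= n%:R :> R by rewrite ler1n; lia.
have ln1 : 1 <= ln n%:R :> R.
  rewrite -[leLHS]expRK ler_ln ?posrE ?expR_gt0 ?(lt_le_trans _ n1) //.
  by rewrite (le_trans hN) // ler_nat; lia.
have tlb k : K%:R^-1 * (n%:R / ln n%:R ^+ k) <= t%:R :> R.
  rewrite ler_pdivrMl ?ltr0n // -natrM; apply: (@le_trans _ _ n%:R);
    last by rewrite ler_nat.
  by rewrite ler_pdivrMr ?exprn_gt0 ?(lt_le_trans _ ln1) // ler_peMr ?exprn_ege1.
exists t%:R, n%:R, t%:R, (slot_mx rho s); split; first exact: tlb.
split; first split=> //.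
  rewrite mul1r -[leLHS]mulr1; apply: ler_pM; rewrite ?ler0n ?ler01 //.
    exact: ler_eXnr.
  exact: exprn_ege1.
split; first exact: tlb.
split.
  move=> i; rewrite /sparse (le_trans (_ : _ <= 120%:R)) ?ler_nat //.
    by rewrite (leq_trans (l0norm_row_slot_mx _ _ _)).
  by rewrite -[leLHS]mulr1 ler_wpM2l // exprn_ege1.
split.
  move=> x S dx St; apply: (near_kernel_not_sparse _ s1 exp _ dx); first by lia.
  by move: St; rewrite ler_nat; lia.
split.
  move=> B; rewrite ler_nat => Bt.
  have mn : (n./2 <= n)%N by rewrite -divn2 leq_div.
  have [C [CB hC]] := robust_sparse_recovery mn s1 exp Bt.
  by exists C; split=> // x; have [|] := hC x; [left|right; rewrite ler_nat].
split.
  apply: (le_trans (frobenius_gram_le rho s1)).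
  by rewrite mulrC ler_wpM2l ?exprn_ge0 ?ler0n // ler_peMr ?ler0n.
have M0 : slot_mx rho s != 0 by apply: slot_mx_neq0 exp => //; lia.
have [lam [lamE lam1]] := smallest_nonzero_eigenvalue_ge1 M0 coer.
exists lam; split=> //; rewrite mul1r (le_trans _ lam1) //.
rewrite -[leRHS](powRr0 n%:R) ler_powR // oppr_le0; lra.
Qed.
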